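(* Let $X$ be a real Banach space and let $Y$ be a closed subspace of $X$ such that every separable (closed) subspace of $Y$ has property-$(SU)$ in $X$. Then $Y$ has property-$(SU)$ in $X$.
   Context: For a closed subspace $Y$ of $X$, $Y^\perp=\{x^*\in X^*: x^*(y)=0\ \forall y\in Y\}$. $Y$ has property-$(SU)$ in $X$ if there is a closed subspace $G$ of $X^*$ with $X^*=G\oplus Y^\perp$ such that for each $x^*\in X^*$, $\|x^*\|>\|y^\#\|$ whenever $x^*=y^\#+y^\perp$ with $y^\#\in G$ and $0\neq y^\perp\in Y^\perp$. *)

(* Defs.v *)
From HB Require Import structures.
From mathcomp Require Import all_boot all_order all_algebra.
From mathcomp Require Import boolp classical_sets functions cardinality.
From mathcomp Require Import reals topology normedtype.

Set Implicit Arguments.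
Unset Strict Implicit.
Unset Printing Implicit Defensive.

Import Order.TTheory GRing.Theory Num.Theory.
Import numFieldNormedType.Exports.

Local Open Scope classical_set_scope.
Local Open Scope ring_scope.

Section Dual.
Variables (R : realType) (X : normedModType R).

Definition dual_pred : {pred X -> R^o} :=
  fun f => `[< linear f /\ continuous f >].

Record dual := Dual {
  dual_fun :> X -> R^o;
  dual_funP : dual_fun \in dual_pred }.

HB.instance Definition _ := [isSub of dual for dual_fun].
HB.instance Definition _ := [Choice of dual by <:].

Lemma dual_pred_submod_closed : submod_closed dual_pred.
Proof.
split.
  by apply/asboolP; split=> [a x y|]; rewrite ?scaler0 ?addr0//; exact: cst_continuous.
move=> a f g /asboolP[lf cf] /asboolP[lg cg]; apply/asboolP; split.
  move=> b x y; rewrite !fctE lf lg !scalerDr !scalerA (mulrC a b) -!addrA.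
  by congr (_ + _); rewrite addrCA.
move=> x; apply: (@continuousD R R^o X (a *: f) g x); last exact: cg.
by apply: (@continuousZl_tmp R R^o X f a x); exact: cf.
Qed.
HB.instance Definition _ :=
  GRing.isSubmodClosed.Build R (X -> R^o) dual_pred dual_pred_submod_closed.
HB.instance Definition _ := [SubChoice_isSubLmodule of dual by <:].

Lemma dual_linear (f : dual) : linear f.
Proof. by have /asboolP[] := dual_funP f. Qed.
HB.instance Definition _ (f : dual) :=
  GRing.isLinear.Build R X R^o *:%R f (dual_linear f).

Lemma dual_continuous (f : dual) : continuous f.
Proof. by have /asboolP[] := dual_funP f. Qed.

Definition dual_norm (f : dual) : R := sup [set `|f x| | x in [set x | `|x| <= 1]].

Lemma dual_norm_has_sup (f : dual) :
  has_sup [set `|f x| | x in [set x : X | `|x| <= 1]].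
Proof.
split; first by exists `|f 0|, 0 => //=; rewrite normr0.
have /linear_bounded_continuous/linear_boundedP/pinfty_ex_gt0[M M0 fM] :=
  @dual_continuous f.
exists M => _ [x /= x1 <-]; apply: le_trans (fM x) _.
by rewrite ler_piMr// ltW.
Qed.

Lemma dual_norm_ge (f : dual) x : `|x| <= 1 -> `|f x| <= dual_norm f.
Proof. by move=> x1; apply: sup_upper_bound; [exact: dual_norm_has_sup|exists x]. Qed.

Lemma dual_norm_le (f : dual) (M : R) :
  (forall x, `|x| <= 1 -> `|f x| <= M) -> dual_norm f <= M.
Proof.
move=> fM; apply: ge_sup; first by case: (dual_norm_has_sup f).
by move=> _ [x /= x1 <-]; exact: fM.
Qed.

Lemma dual_normD (f g : dual) : dual_norm (f + g) <= dual_norm f + dual_norm g.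
Proof.
apply: dual_norm_le => x x1; apply: le_trans (ler_normD _ _) _.
by apply: lerD; exact: dual_norm_ge.
Qed.

Lemma dual_normZ (a : R) (f : dual) : dual_norm (a *: f) = `|a| * dual_norm f.
Proof.
have le b g : dual_norm (b *: g) <= `|b| * dual_norm g.
  apply: dual_norm_le => x x1.
  by rewrite [X in X <= _]normrM ler_wpM2l//; exact: dual_norm_ge.
apply/eqP; rewrite eq_le le /=.
have [->|a0] := eqVneq a 0.
  rewrite normr0 mul0r; apply: le_trans (normr_ge0 _) (@dual_norm_ge _ 0 _).
  by rewrite normr0.
rewrite -ler_pdivlMl ?normr_gt0// -normfV; apply: le_trans (le _ _).
by rewrite scalerA mulVf// scale1r.
Qed.

Lemma dual_norm0_eq0 (f : dual) : dual_norm f = 0 -> f = 0.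
Proof.
move=> f0; apply/val_inj/funext => x /=.
have [->|x0] := eqVneq x 0; first exact: linear0.
have : `|f (`|x|^-1 *: x)| <= 0.
  by rewrite -f0 dual_norm_ge// normrZ normfV normr_id mulVf// normr_eq0.
rewrite normr_le0 linearZ /= => /eqP/(congr1 (fun y => `|x| *: y)).
by rewrite scalerA mulfV ?normr_eq0// scale1r scaler0.
Qed.

HB.instance Definition _ :=
  Lmodule_isNormed.Build R dual dual_normD dual_normZ dual_norm0_eq0.

End Dual.

Definition closed_subspace (R : numFieldType) (V : normedModType R)
    (Y : set V) : Prop :=
  submod_closed [in Y] /\ closed Y.

Definition separable (T : topologicalType) (A : set T) : Prop :=
  exists D : set T, [/\ countable D, D `<=` A & A `<=` closure D].

(* For closed subspaces of a Banach space this algebraic condition is also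
   the topological one, by the open mapping theorem. *)
Definition direct_sum (R : numFieldType) (V : normedModType R)
    (G H : set V) : Prop :=
  [set g + h | g in G & h in H] = [set: V] /\ G `&` H = [set 0].

Definition annihilator (R : realType) (X : normedModType R) (Y : set X)
    : set (dual X) :=
  [set f | forall y, Y y -> f y = 0].

Definition property_SU (R : realType) (X : normedModType R) (Y : set X)
    : Prop :=
  exists G : set (dual X),
    [/\ closed_subspace G,
        direct_sum G (annihilator Y)
      & forall f g h : dual X, f = g + h -> G g -> annihilator Y h ->
          h != 0 -> `|g| < `|f|].

(* Main.v *)
Require Import Defs.
From mathcomp Require Import all_boot all_order all_algebra.
From mathcomp Require Import boolp classical_sets functions cardinality.
From mathcomp Require Import reals topology normedtype.
From mathcomp Require Import lra.

(** Call [g] in the dual strictly minimal over a set [D] when adding a nonzero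
    element of the annihilator of [D] strictly increases the norm of [g].  When
    [D] has property-(SU), the complement of the annihilator is forced to be the
    set [U D] of these functionals ([property_SUP]), so no choice of complements
    has to be made coherent.  Moreover [U D] increases with [D], because the
    annihilator decreases ([strictly_minimalS]).

    Every countable [D] inside [Y] has property-(SU), since it has the same
    annihilator as a separable closed subspace of [Y]
    ([property_SU_countable]).  Let [G] be the union of the sets [U D] over
    countable [D] inside [Y].  Countable unions of countable sets are countable,
    so any sequence in [G] lies in a single [U D], which is a closed subspace;
    hence [G] is itself a closed subspace ([countable_minimal_subspace]).  By
    monotonicity the elements of [G] are strictly minimal over [Y].

    It remains to split a functional [f] along [G]
    ([countable_minimal_decomposition]).  For countable [D] let [p D] be the
    component of [f] in [U D].  Its norm is nondecreasing in [D] and bounded by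
    that of [f], and its supremum is attained at some countable [E], the union
    of a maximizing sequence.  Adding one point [y] of [Y] to [E] cannot increase
    the norm, so strict minimality gives [p (E + y) = p E]; as [p (E + y)] agrees
    with [f] at [y], so does [p E].  Thus [f - p E] vanishes on [Y]. *)

Import Order.TTheory GRing.Theory Num.Theory.
Import numFieldNormedType.Exports.

Local Open Scope classical_set_scope.
Local Open Scope ring_scope.

(** * Separable closed subspaces generated by countable sets *)

Lemma closure_normP (R : realType) (V : normedModType R) (A : set V) (x : V) :
  closure A x <-> forall e, 0 < e -> exists2 a, A a & `|x - a| < e.
Proof.
split=> [clA e e0 | xA B /nbhs_ballP[e /= e0 eB]].
  have [a [Aa]] := clA _ (nbhsx_ballx x e e0).
  by rewrite -ball_normE => xa; exists a.
have [a Aa xa] := xA e e0; exists a; split => //.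
by apply: eB; rewrite -ball_normE.
Qed.

Lemma closed_subspaceP (R : numFieldType) (V : normedModType R) (Y : set V) :
  closed_subspace Y <->
  [/\ Y 0, forall a u v, Y u -> Y v -> Y (a *: u + v) & closed Y].
Proof.
split=> [[[Y0 YD] clY] | [Y0 YD clY]].
  split=> // [|a u v Yu Yv]; first by move: Y0; rewrite in_setE.
  by move: (YD a u v); rewrite !in_setE; exact.
split=> //; split=> [|a u v]; rewrite !in_setE//; exact: YD.
Qed.

(** Rational scalars suffice because they are dense: real multiples are
    recovered in the closure.  This keeps the generating set countable. *)
Lemma closure_rat_submod (R : realType) (V : normedModType R) (E : set V) :
  E 0 -> (forall (q : rat) u v, E u -> E v -> E (ratr q *: u + v)) ->
  closed_subspace (closure E).
Proof.
move=> E0 ED; apply/closed_subspaceP.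
split; [exact: subset_closure | | exact: closed_closure].
move=> a u v /closure_normP clu /closure_normP clv; apply/closure_normP => e e0.
have e3 : 0 < e / 3 by rewrite divr_gt0.
have u1 : 0 < `|u| + 1 by rewrite ltr_wpDl.
(* The tolerances are chosen so that the three errors below, from the scalar,
   from [u] and from [v], are each at most [e / 3]; adding 1 to the norms keeps
   the denominators positive. *)
have [q] := @rat_in_itvoo R a (a + e / 3 / (`|u| + 1)) (ltac:(by rewrite ltrDl divr_gt0)).
rewrite in_itv /= => /andP[aq qa].
have q1 : 0 < `|ratr q : R| + 1 by rewrite ltr_wpDl.
have [u' Eu' uu'] := clu (e / 3 / (`|ratr q : R| + 1)) (ltac:(by rewrite divr_gt0)).
have [v' Ev' vv'] := clv _ e3.
exists (ratr q *: u' + v'); first exact: ED.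
have -> : a *: u + v - (ratr q *: u' + v') =
    (a - ratr q) *: u + ratr q *: (u - u') + (v - v').
  by rewrite opprD addrACA scalerBl scalerBr subrKA.
have eE : e = e / 3 + e / 3 + e / 3 by lra.
rewrite [ltRHS]eE.
apply: le_lt_trans (ler_normD _ _) _; apply: ler_ltD => //.
apply: le_trans (ler_normD _ _) _; rewrite (normrZ (a - _)) (normrZ (ratr q)); apply: lerD.
  have ae : `|a - ratr q| <= e / 3 / (`|u| + 1).
    by rewrite distrC gtr0_norm ?subr_gt0// lerBlDl ltW.
  apply: le_trans (ler_wpM2r _ ae) _ => //.
  by rewrite mulrAC ler_pdivrMr// ler_wpM2l ?ltW// ltrDl.
apply: le_trans (ler_wpM2l _ (ltW uu')) _ => //.
by rewrite mulrC mulrAC ler_pdivrMr// ler_wpM2l ?ltW// ltrDl.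
Qed.

(** The hull is the closure of the set of rational linear combinations of
    elements of [D]. *)
Lemma separable_hull (R : realType) (V : normedModType R) (Y D : set V) :
  closed_subspace Y -> countable D -> D `<=` Y ->
  exists Z : set V, [/\ closed_subspace Z, separable Z, D `<=` Z, Z `<=` Y &
    forall W, closed_subspace W -> D `<=` W -> Z `<=` W].
Proof.
move=> Ysub Dct DY.
(* Adding 0 makes the set nonempty, so that a sequence [d] enumerates it. *)
have /pfcard_geP[|[d]] : (D `|` [set 0] #<= [set: nat])%card.
- rewrite -bigcup2E; apply: bigcup_countable => // -[|[|i]] _ //=.
- by move=> /seteqP[/(_ 0) /= s _]; case: s; right.
pose c (s : seq (rat * nat)) : V := \sum_(p <- s) ratr p.1 *: d p.2.
have ccons p s : c (p :: s) = ratr p.1 *: d p.2 + c s by rewrite /c big_cons.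
have hull W : closed_subspace W -> D `<=` W -> closure (range c) `<=` W.
  move=> /closed_subspaceP[W0 WD clW] DW; apply: subset_trans clW.
  apply: closure_subset => _ [s _ <-].
  elim: s => [|p s IH]; first by rewrite /c big_nil.
  rewrite ccons; apply: WD => //.
  by have [/DW|->] : (D `|` [set 0]) (d p.2) by exact: funS.
exists (closure (range c)); split; last exact: hull.
- apply: closure_rat_submod; first by exists [::] => //; rewrite /c big_nil.
  move=> q _ _ [s _ <-] [t _ <-].
  exists ([seq (q * p.1, p.2) | p <- s] ++ t) => //.
  rewrite /c big_cat big_map scaler_sumr; congr (_ + _).
  by apply: eq_bigr => p _; rewrite scalerA rmorphM.
- exists (range c); split=> //; last exact: subset_closure.
  exact: card_le_trans (card_image_le _ _) (countableP _).
- move=> x Dx; apply: subset_closure.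
  have [n _ <-] : (d @` setT) x by apply: surj; left.
  by exists [:: (1, n)] => //; rewrite ccons /c big_nil addr0 rmorph1 scale1r.
- exact: hull.
Qed.

(** * Functionals of strictly minimal norm *)

Section MinimalFunctionals.
Variables (R : realType) (X : normedModType R).
Implicit Types (D Z Y : set X) (f g h : dual X).

Lemma annihilatorB {D f g} :
  annihilator D f -> annihilator D g -> annihilator D (f - g).
Proof. by move=> Df Dg y Dy; rewrite [LHS](_ : _ = f y - g y)// Df// Dg// subr0. Qed.

Lemma annihilatorN {D f} : annihilator D f -> annihilator D (- f).
Proof. by move=> Df y Dy; rewrite [LHS](_ : _ = - f y)// Df// oppr0. Qed.

Lemma annihilatorS {D D'} : D `<=` D' -> annihilator D' `<=` annihilator D.
Proof. by move=> DD' f D'f y /DD'; exact: D'f. Qed.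

Lemma closed_subspace_ker f : closed_subspace [set x | f x = 0].
Proof.
apply/closed_subspaceP; split=> [|a u v /= fu fv|]; first exact: linear0.
  by rewrite dual_linear fu fv scaler0 addr0.
have -> : [set x | f x = 0] = f @^-1` [set 0] by [].
apply: closed_comp => [x _|]; first exact: dual_continuous.
exact: closed_eq.
Qed.

Definition strictly_minimal D : set (dual X) :=
  [set g | forall h, annihilator D h -> h != 0 -> `|g| < `|g + h|].

Lemma strictly_minimalS {D D'} :
  D `<=` D' -> strictly_minimal D `<=` strictly_minimal D'.
Proof. by move=> /annihilatorS DD' g Dg h /DD'; exact: Dg. Qed.

Lemma strictly_minimal_eq {D f g} : strictly_minimal D g ->
  annihilator D (f - g) -> `|f| <= `|g| -> f = g.
Proof.
move=> Dg Dfg fg; apply/eqP; rewrite -subr_eq0; apply/negP => /negP fg0.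
by have := Dg _ Dfg fg0; rewrite addrC subrK ltNge fg.
Qed.

Lemma strictly_minimal_le {D f g} : strictly_minimal D g ->
  annihilator D (f - g) -> `|g| <= `|f|.
Proof.
move=> Dg Dfg; rewrite leNgt; apply/negP => fg.
by move: (fg); rewrite (strictly_minimal_eq Dg Dfg (ltW fg)) ltxx.
Qed.

Lemma strictly_minimal_annihilator {D g} :
  strictly_minimal D g -> annihilator D g -> g = 0.
Proof.
move=> Dg gD; apply/eqP; apply/negP => /negP g0.
have := Dg (- g) (annihilatorN gD).
by rewrite oppr_eq0 subrr normr0 ltNge normr_ge0; move=> /(_ g0).
Qed.

(** A complement of the annihilator that consists of strictly minimal
    functionals is all that property-(SU) asks for: such a functional lying in
    the annihilator is 0, so the sum is automatically direct. *)
Lemma property_SU_intro {D} {G : set (dual X)} :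
  closed_subspace G -> G `<=` strictly_minimal D ->
  (forall f, exists2 g, G g & annihilator D (f - g)) -> property_SU D.
Proof.
move=> Gsub GD Gdec; exists G; split=> //; last first.
  by move=> _ g h -> Gg Dh h0; exact: GD Gg _ Dh h0.
(split; apply/seteqP; split)=> // [f _|g [Gg gD]|_ ->].
- have [g Gg Dfg] := Gdec f.
  by exists g => //; exists (f - g) => //; rewrite addrC subrK.
- exact: strictly_minimal_annihilator (GD _ Gg) gD.
- split; last by [].
  by have /closed_subspaceP[] := Gsub.
Qed.

(** The complement [G] in property-(SU) is determined by [D]: it can only be the
    set of strictly minimal functionals.  Indeed if [g] is strictly minimal and
    [g = g' + h] with [g'] in [G] and [h != 0] in the annihilator, then the norms
    of [g] and [g'] are each smaller than the other. *)
Lemma property_SUP D : property_SU D <->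
  closed_subspace (strictly_minimal D) /\
  forall f, exists2 g, strictly_minimal D g & annihilator D (f - g).
Proof.
split=> [[G [Gsub [GD _] Gmin]] | [Usub Udec]].
  have GU : G = strictly_minimal D.
    apply/seteqP; split=> [g Gg h Dh h0|g Dg]; first exact: Gmin Dh h0.
    have [g' Gg' [h Dh gE]] : [set g + h | g in G & h in annihilator D] g.
      by rewrite GD.
    have [h0|h0] := eqVneq h 0; first by rewrite -gE h0 addr0.
    have := Dg _ (annihilatorN Dh).
    rewrite oppr_eq0 -{2}gE addrK => /(_ h0).
    by rewrite ltNge ltW// (Gmin g g' h).
  split; first by rewrite -GU.
  move=> f; rewrite -GU.
  have [g Gg [h Dh fE]] : [set g + h | g in G & h in annihilator D] f.
    by rewrite GD.
  by exists g => //; rewrite -fE addrC addKr.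
exact: property_SU_intro Usub _ Udec.
Qed.

(** A functional vanishing on [D] vanishes on the closed subspace that [D]
    generates, so [D] and this subspace share their annihilator, which is all
    that property-(SU) sees. *)
Lemma property_SU_countable Y D : closed_subspace Y ->
  (forall Z, closed_subspace Z -> separable Z -> Z `<=` Y -> property_SU Z) ->
  countable D -> D `<=` Y -> property_SU D.
Proof.
move=> Ysub hsep Dct DY.
have [Z [Zsub Zsep DZ ZY Zmin]] := separable_hull _ _ _ _ Ysub Dct DY.
have DZE : annihilator D = annihilator Z.
  apply/seteqP; split=> [f Df|]; last exact: annihilatorS.
  exact: Zmin (closed_subspace_ker f) Df.
by have := hsep Z Zsub Zsep ZY; rewrite /property_SU DZE.
Qed.

(** * From countable subsets to the whole set *)

Section CountablySupported.
Variable Y : set X.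
Hypothesis SUct : forall D, countable D -> D `<=` Y -> property_SU D.

Definition countable_minimal : set (dual X) :=
  [set g | exists D, [/\ countable D, D `<=` Y & strictly_minimal D g]].

(** Countably many witnesses can be merged, by monotonicity of strict
    minimality; this is what transfers the closed subspace structure to the
    union. *)
Lemma countable_minimal_seq (g : nat -> dual X) :
  (forall n, countable_minimal (g n)) ->
  exists D, [/\ countable D, D `<=` Y & forall n, strictly_minimal D (g n)].
Proof.
move=> /choice[D PD]; exists (\bigcup_n D n); split.
- by apply: bigcup_countable => // n _; have [] := PD n.
- by move=> x [n _]; have [_ + _] := PD n; exact.
- move=> n; have [_ _] := PD n; apply: strictly_minimalS.
  exact: bigcup_sup.
Qed.

Lemma countable_minimal_subspace : closed_subspace countable_minimal.
Proof.
apply/closed_subspaceP; split.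
- exists set0; split=> //.
  have /property_SUP[/closed_subspaceP[U0 _ _] _] := SUct _ (countable0 X) (sub0set Y).
  exact: U0.
- move=> a u v Gu Gv.
  have [|D [Dct DY UD]] :=
    countable_minimal_seq (fun n => if n is 0%N then u else v).
    by case.
  have /property_SUP[/closed_subspaceP[_ Ulin _] _] := SUct _ Dct DY.
  by exists D; split=> //; apply: Ulin; [exact: (UD 0%N)|exact: (UD 1%N)].
- move=> f /closure_normP clf.
  have /choice[g fg] : forall n : nat, exists g,
      countable_minimal g /\ `|f - g| < n.+1%:R^-1.
    by move=> n; have [|g] := clf n.+1%:R^-1 _; [rewrite invr_gt0|exists g].
  have [|D [Dct DY UD]] := countable_minimal_seq g.
    by move=> n; have [] := fg n.
  have /property_SUP[/closed_subspaceP[_ _ Ucl] _] := SUct _ Dct DY.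
  exists D; split=> //; apply: Ucl; apply/closure_normP => e e0.
  have [n] := ltr_add_invr e0; rewrite add0r => ne.
  by exists (g n) => //; apply: lt_trans ne; have [] := fg n.
Qed.

(** The component of [f] over a countable set of maximal norm no longer changes
    when a point of [Y] is added to the set, hence agrees with [f] there. *)
Lemma countable_minimal_decomposition f :
  exists2 g, countable_minimal g & annihilator Y (f - g).
Proof.
(* [p D] is the component of [f] that is strictly minimal over [D]. *)
have /choice[p pP] : forall D, exists g, countable D -> D `<=` Y ->
    strictly_minimal D g /\ annihilator D (f - g).
  move=> D; have [[Dct DY]|nD] := pselect (countable D /\ D `<=` Y); last first.
    by exists 0 => Dct DY; case: nD.
  by have /property_SUP[_ /(_ f)[g]] := SUct _ Dct DY; exists g.
have pB D D' : countable D -> D `<=` Y -> countable D' -> D' `<=` Y ->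
    D `<=` D' -> annihilator D (p D' - p D).
  move=> Dct DY D'ct D'Y DD'.
  have [_ fD] := pP _ Dct DY; have [_ /(annihilatorS DD') fD'] := pP _ D'ct D'Y.
  have -> : p D' - p D = (f - p D) - (f - p D').
    by rewrite opprB [RHS]addrC subrKA.
  exact: annihilatorB.
pose N := [set `|p D| | D in [set D | countable D /\ D `<=` Y]].
have Nsup : has_sup N.
  split; first by exists `|p set0|, set0 => //; split=> //; exact: sub0set.
  exists `|f| => _ [D [Dct DY] <-].
  by have [UD fD] := pP _ Dct DY; exact: strictly_minimal_le UD fD.
have /choice[D PD] : forall n : nat, exists D,
    [/\ countable D, D `<=` Y & sup N - n.+1%:R^-1 < `|p D|].
  move=> n; have [|_ [D [Dct DY] <-] ND] := @sup_adherent _ N n.+1%:R^-1 _ Nsup.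
    by rewrite invr_gt0.
  by exists D.
pose E := \bigcup_n D n.
have Ect : countable E by apply: bigcup_countable => // n _; have [] := PD n.
have EY : E `<=` Y by move=> x [n _]; have [_ + _] := PD n; exact.
have supE : sup N <= `|p E|.
  rewrite leNgt; apply/negP => /ltr_add_invr[n]; rewrite -ltrBrDr.
  have [Dct DY ND] := PD n => /lt_trans/(_ ND).
  have [UD _] := pP _ Dct DY.
  rewrite ltNge (strictly_minimal_le UD)//.
  by apply: pB => //; exact: bigcup_sup.
have [UE _] := pP _ Ect EY.
exists (p E); first by exists E.
move=> y Yy; pose E' := E `|` [set y].
have E'ct : countable E'.
  by rewrite /E' -bigcup2E; apply: bigcup_countable => // -[|[|i]] _ //=.
have E'Y : E' `<=` Y by move=> x [/EY|->].
have <- : p E' = p E.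
  apply: (strictly_minimal_eq UE); first by apply: pB => //; exact: subsetUl.
  by apply: le_trans supE; apply: sup_upper_bound Nsup _ _; exists E'.
by have [_] := pP _ E'ct E'Y; apply; right.
Qed.

Lemma property_SU_of_countable : property_SU Y.
Proof.
apply: property_SU_intro countable_minimal_subspace _
  countable_minimal_decomposition => g [D [_ DY]].
exact: strictly_minimalS.
Qed.

End CountablySupported.
End MinimalFunctionals.

Theorem proposition2p18 (R : realType) (X : completeNormedModType R)
    (Y : set X) (hY : closed_subspace Y)
    (hsep : forall Z : set X, closed_subspace Z -> separable Z -> Z `<=` Y ->
       property_SU Z) :
  property_SU Y.
Proof.
apply: property_SU_of_countable => D; exact: property_SU_countable hY hsep.
Qed.
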